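(* Let $G_1=(V,D_1,B_1)$ and $G_2=(V,D_2,B_2)$ be two simple mixed graphs on the same vertex set with the same skeleton and the same collider triples. Then $\overline{\mathcal{M}_{G_1}}=\overline{\mathcal{M}_{G_2}}$, i.e., $G_1$ and $G_2$ are distributionally equivalent up to closure.
   Context: A mixed graph with finite vertex set $V$ is a triple $G=(V,D,B)$, where $D$ is a set of ordered pairs $(i,j)$, $i\neq j$ (directed edges $i\to j$, with head $j$) and $B$ a set of unordered pairs $\{i,j\}$, $i\neq j$ (bidirected edges $i\leftrightarrow j$, both endpoints are called heads). $G$ is simple if any two distinct nodes are joined by at most one edge of any type. The skeleton of $G$ is the undirected graph obtained by replacing all edges by undirected edges. A collider triple is a triple of vertices $(i,j,k)$ such that there is an edge between $i$ and $j$ and an edge between $j$ and $k$, with $j$ a head of both edges (i.e. $i\to j\leftarrow k$, $i\leftrightarrow j\leftarrow k$, $i\to j\leftrightarrow k$, or $i\leftrightarrow j\leftrightarrow k$), regardless of whether $i$ and $k$ are adjacent. $\mathbb{R}^D_{\mathrm{reg}}$ is the set of real $V\times V$ matrices $\Lambda$ with $\lambda_{ij}=0$ for $(i,j)\notin D$ and $I-\Lambda$ invertible; $\mathit{PD}(B)$ is the set of positive definite $V\times V$ matrices $\Omega$ with $\omega_{ij}=0$ for $i\ne j$, $\{i,j\}\notin B$. $\mathcal{M}_G=\{(I-\Lambda)^{-T}\Omega(I-\Lambda)^{-1}:\Lambda\in\mathbb{R}^D_{\mathrm{reg}},\Omega\in\mathit{PD}(B)\}$, and $\overline{\mathcal{M}_G}$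 denotes its closure in the Euclidean topology. *)

(* Defs.v *)
From mathcomp Require Import all_boot all_order all_algebra.
From mathcomp Require Import all_classical all_reals all_analysis.
Import numFieldNormedType.Exports.

Set Implicit Arguments.
Unset Strict Implicit.
Unset Printing Implicit Defensive.
Import Order.TTheory GRing.Theory Num.Theory.
Local Open Scope classical_set_scope.
Local Open Scope ring_scope.

(* A mixed graph on the vertex set V = 'I_n:
   mg_D i j  <=>  (i,j) in D, i.e. the directed edge i -> j;
   mg_B i j  <=>  {i,j} in B, i.e. the bidirected edge i <-> j. *)
Record mixed_graph (n : nat) := MixedGraph {
  mg_D : rel 'I_n;
  mg_B : rel 'I_n }.

Definition wf_mixed_graph n (G : mixed_graph n) : Prop :=
  (forall i, ~~ mg_D G i i) /\ (forall i, ~~ mg_B G i i) /\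
  (forall i j, mg_B G i j = mg_B G j i).

Definition simple_mixed_graph n (G : mixed_graph n) : Prop :=
  wf_mixed_graph G /\
  forall i j, i != j ->
    [&& ~~ (mg_D G i j && mg_D G j i),
        ~~ (mg_D G i j && mg_B G i j) &
        ~~ (mg_D G j i && mg_B G i j)].

Definition adjacent n (G : mixed_graph n) (i j : 'I_n) : bool :=
  [|| mg_D G i j, mg_D G j i | mg_B G i j].

Definition same_skeleton n (G1 G2 : mixed_graph n) : Prop :=
  forall i j, adjacent G1 i j = adjacent G2 i j.

Definition head_at n (G : mixed_graph n) (i j : 'I_n) : bool :=
  mg_D G i j || mg_B G i j.

Definition collider n (G : mixed_graph n) (i j k : 'I_n) : bool :=
  [&& i != k, head_at G i j & head_at G k j].

Definition same_colliders n (G1 G2 : mixed_graph n) : Prop :=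
  forall i j k, collider G1 i j k = collider G2 i j k.

Definition posdef (R : realType) n (M : 'M[R]_n) : Prop :=
  M^T = M /\ forall v : 'cV[R]_n, v != 0 -> 0 < (v^T *m M *m v) 0 0.

Definition RDreg (R : realType) n (G : mixed_graph n) (L : 'M[R]_n) : Prop :=
  (forall i j, ~~ mg_D G i j -> L i j = 0) /\ (1%:M - L) \in unitmx.

Definition PDB (R : realType) n (G : mixed_graph n) (O : 'M[R]_n) : Prop :=
  posdef O /\ (forall i j, i != j -> ~~ mg_B G i j -> O i j = 0).

Arguments RDreg : clear implicits.
Definition model (R : realType) n (G : mixed_graph n) : set 'M[R]_n :=
  [set S | exists L O, RDreg R n G L /\ PDB G O /\
     S = (invmx (1%:M - L))^T *m O *m invmx (1%:M - L)].
Arguments model R {n} G.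

(* Main.v *)
(** If [G1] and [G2] disagree about a head at [j], then [j] has at most one head
in each graph, since two heads would form a collider. When [r] has no head at
all, [r -> t] and [r <-> t] parametrize the same covariance matrices, so a head
may be added or removed at such an [r]; neither the skeleton nor the colliders
change. When no such move brings the graphs closer, the vertices where they
differ form disjoint directed cycles that are reversed from [G1] to [G2] and
carry no further heads. A cycle is reversed by solving each of its structural
equations for the other variable. This requires nonzero edge coefficients,
which is the only place where the closure is needed. *)

Require Import Defs.
From mathcomp Require Import all_boot all_order all_algebra.
From mathcomp Require Import all_classical all_reals all_analysis.
From mathcomp Require Import perm.
Import numFieldNormedType.Exports.
Local Open Scope classical_set_scope.
Local Open Scope ring_scope.

Set Implicit Arguments.
Unset Strict Implicit.
Unset Printing Implicit Defensive.
Import Order.TTheory GRing.Theory Num.Theory.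

(** * Density of the parameters with nonzero edge coefficients *)

Definition cov (R : realType) n (L O : 'M[R]_n) : 'M[R]_n :=
  (invmx (1%:M - L))^T *m O *m invmx (1%:M - L).

Definition generic_model (R : realType) n (G : mixed_graph n) : set 'M[R]_n :=
  [set S | exists L O, [/\ RDreg R n G L, forall i j, mg_D G i j -> L i j != 0,
                           PDB G O & S = cov L O]].

(** Shifting all edge coefficients by one small [x != 0] makes them nonzero, and the covariance
    matrix depends continuously on [x]. *)
Lemma model_sub_closure_generic (R : realType) n (G : mixed_graph n) :
  model R G `<=` closure (@generic_model R n G).
Proof.
move=> _ [L [Om [[LD Lunit] [OB ->]]]].
pose N : 'M[R]_n := \matrix_(i, j) (mg_D G i j)%:R.
(* By Cramer's rule the covariance matrix at [L + x *: N] has the entries [Qp i j / Dp ^ 2]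
   evaluated at [x], so continuity at 0 reduces to that of polynomials with [Dp.[0] != 0]. *)
pose Ap : 'M[{poly R}]_n := map_mx polyC (1%:M - L) - 'X *: map_mx polyC N.
pose Dp := \det Ap.
pose Qp := (\adj Ap)^T *m map_mx polyC Om *m \adj Ap.
have ApE x : map_mx (horner_eval x) Ap = 1%:M - (L + x *: N).
  by apply/matrixP => i j; rewrite !mxE /= /horner_eval !hornerE opprD addrA.
have DpE x : Dp.[x] = \det (1%:M - (L + x *: N)).
  by rewrite -ApE det_map_mx.
have covE x : Dp.[x] != 0 ->
    cov (L + x *: N) Om = \matrix_(i, j) (Dp.[x]^-1 ^+ 2 * (Qp i j).[x]).
  move=> Dx; rewrite /cov /invmx unitmxE -DpE unitfE Dx -ApE -map_mx_adj.
  rewrite [(_ *: _)^T]linearZ /= -!scalemxAl -scalemxAr scalerA -expr2.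
  have -> : Om = map_mx (horner_eval x) (map_mx polyC Om).
    by apply/matrixP => i j; rewrite !mxE /horner_eval hornerC.
  rewrite map_trmx -!map_mxM -/Qp.
  by apply/matrixP => i j; rewrite !mxE.
have D0 : Dp.[0] != 0 by rewrite DpE scale0r addr0 -unitfE -unitmxE.
have Dcont : Dp.[x] @[x --> 0] --> Dp.[0] by exact: continuous_horner.
have Dnear : \forall x \near (0 : R), Dp.[x] != 0.
  have := open_nbhs_nbhs (conj (@open_neq R 0) (D0 : [set x | x != 0] Dp.[0])).
  exact: Dcont.
have covcont i j : Dp.[x]^-1 ^+ 2 * (Qp i j).[x] @[x --> (0:R)]
    --> cov L Om i j.
  have -> : cov L Om i j = Dp.[0]^-1 ^+ 2 * (Qp i j).[0].
    by have := covE _ D0; rewrite scale0r addr0 => ->; rewrite mxE.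
  apply: cvgM; last exact: continuous_horner.
  by rewrite expr2; apply: cvgM; apply: cvgV.
move=> B [P PE sPB].
(* The punctured neighbourhood excludes [x = 0], where vanishing edge coefficients would stay
   zero. *)
near (0 : R)^' => x.
have x0 : x != 0 by near: x; exact: nbhs_dnbhs_neq.
have Dx : Dp.[x] != 0 by near: x; exact: nbhs_dnbhs.
exists (cov (L + x *: N) Om); split; last first.
  apply: sPB => i j; rewrite covE // mxE; move: i j; near: x.
  apply: filter_forall => i; apply: filter_forall => j.
  by apply: nbhs_dnbhs; exact: covcont (PE i j).
exists (L + x *: N), Om; split=> //.
- split; last by rewrite unitmxE -DpE unitfE.
  by move=> i j Dij; rewrite !mxE LD // (negbTE Dij) mulr0 addr0.
- move=> i j Dij; rewrite !mxE Dij mulr1; move: i j Dij; near: x.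
  apply: filter_forall => i; apply: filter_forall => j.
  have [Lij|Lij] := eqVneq (L i j) 0.
    near=> x => _; rewrite Lij add0r.
    by near: x; exact: nbhs_dnbhs_neq.
  have Lpos : 0 < `|L i j| by rewrite normr_gt0.
  near=> x => _; rewrite addr_eq0; apply/eqP => Lx.
  have : `|x| < `|L i j| by near: x; exact: dnbhs0_lt.
  by rewrite Lx normrN ltxx.
Unshelve. all: by end_near. Qed.

(** * Reparametrization by column operations *)

Lemma posdef_congr (R : realType) n (Om P : 'M[R]_n) :
  posdef Om -> P \in unitmx -> posdef (P^T *m Om *m P).
Proof.
move=> [Osym Opos] Punit; split.
  by rewrite !trmx_mul trmxK Osym mulmxA.
move=> v v0; have := Opos (P *m v).
rewrite trmx_mul !mulmxA; apply; apply: contra_neq v0 => Pv.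
by rewrite -(mulKmx Punit v) Pv mulmx0.
Qed.

(* The new parameters are given by [I - L' = (I - L) P] and [P^T O P]. *)
Lemma model_recombine (R : realType) n (G : mixed_graph n) (L O P : 'M[R]_n) :
  1%:M - L \in unitmx -> posdef O -> P \in unitmx ->
  (forall i j, ~~ mg_D G i j -> ((1%:M - L) *m P) i j = (i == j)%:R) ->
  (forall i j, i != j -> ~~ mg_B G i j -> (P^T *m O *m P) i j = 0) ->
  model R G (cov L O).
Proof.
move=> Lunit Opos Punit LD OB.
exists (1%:M - (1%:M - L) *m P), (P^T *m O *m P).
have E : 1%:M - (1%:M - (1%:M - L) *m P) = (1%:M - L) *m P by rewrite subKr.
split; [split|split].
- by move=> i j /LD; rewrite !mxE => ->; rewrite subrr.
- by rewrite E unitmx_mul Lunit.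
- by split=> //; exact: posdef_congr.
- rewrite E /cov.
  have -> : invmx ((1%:M - L) *m P) = invmx P *m invmx (1%:M - L).
    have PLunit : (1%:M - L) *m P \in unitmx by rewrite unitmx_mul Lunit.
    rewrite -[RHS](mulKmx PLunit) -[(1%:M - L) *m P *m _]mulmxA (mulKVmx Punit).
    by rewrite mulmxV // mulmx1.
  rewrite trmx_mul !mulmxA; congr (_ *m _).
  rewrite -!mulmxA; congr (_ *m _).
  by rewrite mulmxV // mulmx1 mulmxA -trmx_mul mulmxV // trmx1 mul1mx.
Qed.

Lemma add_transvection_unit (R : realType) n (r t : 'I_n) (c : R) :
  r != t -> 1%:M + c *: delta_mx r t \in unitmx.
Proof.
(* As [r != t], [delta_mx r t] squares to zero, so changing the sign of [c] gives the inverse. *)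
move=> rt; apply: (proj1 (mulmx1_unit (B := 1%:M - c *: delta_mx r t) _)).
rewrite mulmxBr mulmx1 mulmxDl mul1mx -scalemxAl -scalemxAr mul_delta_mx_0.
  by rewrite !scaler0 addr0 addrK.
by rewrite eq_sym.
Qed.

Lemma transvectionE (R : realType) n (A : 'M[R]_n) (r t : 'I_n) (c : R) i j :
  (A *m (1%:M + c *: delta_mx r t)) i j = A i j + c * (A i r *+ (j == t)).
Proof.
rewrite mulmxDr mulmx1 -scalemxAr !mxE; congr (_ + _ * _).
rewrite (bigD1 r) //= big1 ?addr0 => [|k /negbTE kr].
  by rewrite mxE eqxx mulr_natr.
by rewrite mxE kr mulr0.
Qed.

Lemma transvection_congrE (R : realType) n (A : 'M[R]_n) (r t : 'I_n) (c : R)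
    (P := 1%:M + c *: delta_mx r t) i j :
  (P^T *m A *m P) i j = A i j + c * (A r j *+ (i == t)) +
    c * ((A i r + c * (A r r *+ (i == t))) *+ (j == t)).
Proof.
have PAE k l : (P^T *m A) k l = A k l + c * (A r l *+ (k == t)).
  by rewrite -[P^T *m A]trmxK trmx_mul trmxK mxE transvectionE !mxE.
by rewrite transvectionE !PAE.
Qed.

(** * Head relations, and moves at a headless vertex *)

(* A simple mixed graph is determined by its relation "[i] and [j] are joined
   by an edge with head [j]". *)
Definition graph_of_heads n (h : rel 'I_n) : mixed_graph n :=
  MixedGraph (fun i j => h i j && ~~ h j i) (fun i j => h i j && h j i).

Lemma head_atK n (G : mixed_graph n) :
  simple_mixed_graph G -> graph_of_heads (head_at G) = G.
Proof.
case: G => D B [[/= Dirr [Birr Bsym]] Gsimple]; rewrite /graph_of_heads /head_at /=.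
have E i j : ((D i j || B i j) && ~~ (D j i || B j i) = D i j) /\
             ((D i j || B i j) && (D j i || B j i) = B i j).
  have [<-|ij] := eqVneq i j.
    by rewrite (negbTE (Dirr i)) (negbTE (Birr i)).
  have := Gsimple i j ij; rewrite /= (Bsym j i).
  by case: (D i j); case: (D j i); case: (B i j).
by congr MixedGraph; apply/funext => i; apply/funext => j; case: (E i j).
Qed.

(* With [X_r] exogenous, [r -> t] with coefficient [c] and [r <-> t] with
   noise covariance [c * Var X_r] produce the same joint law. *)
Lemma model_add_head (R : realType) n (h h' : rel 'I_n) (r t : 'I_n) :
  irreflexive h -> h r t -> (forall k, h k r = false) ->
  (forall i j, h' i j = h i j || (i == t) && (j == r)) ->
  model R (graph_of_heads h) = model R (graph_of_heads h').
Proof.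
move=> hirr hrt hr h'E.
have rt : r != t by apply: contraTneq hrt => ->; rewrite hirr.
have tr : t != r by rewrite eq_sym.
have h'hr k : h' k r = (k == t) by rewrite h'E hr eqxx andbT.
have h'r i j : j != r -> h' i j = h i j.
  by move=> /negbTE jr; rewrite h'E jr andbF orbF.
apply/seteqP; split=> _ [L [Om [[LD Lunit] [[Opos OB] ->]]]].
- have Lr i : L i r = 0 by apply: LD; rewrite /= hr.
  have Or j : r != j -> Om r j = 0 by move=> rj; apply: OB => //=; rewrite hr andbF.
  have Or' j : j != r -> Om j r = 0 by move=> rj; apply: OB => //=; rewrite hr.
  (* Column [r] of [1%:M - L] is a unit vector, so the operation only cancels the coefficient of
     [r -> t]. Off the diagonal, the noise matrix changes only at [(r, t)] and [(t, r)]. *)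
  apply: (model_recombine (P := 1%:M + L r t *: delta_mx r t)) => //=.
  + exact: add_transvection_unit.
  + move=> i j D'ij; rewrite transvectionE !mxE Lr subr0.
    have [jt|jt] := eqVneq j t.
      have [->|ir] := eqVneq i r.
        by rewrite jt mulr1 (negbTE rt) sub0r addNr.
      rewrite mulr0 addr0 LD ?subr0 //=; apply: contra D'ij.
      by rewrite jt (h'r _ t) // (h'r _ i) //.
    rewrite mulr0n mulr0 addr0; have [->|jr] := eqVneq j r; first by rewrite Lr subr0.
    by rewrite LD ?subr0 //=; move: D'ij; rewrite (h'r _ j) // h'E (negbTE jt) andFb orbF.
  + move=> i j ij B'ij; rewrite transvection_congrE.
    have Oij : Om i j = 0.
      apply: OB => //; apply: contra B'ij => /= /andP[hij hji].
      by rewrite !h'E hij hji.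
    rewrite Oij add0r.
    have [it|it] := eqVneq i t.
      have jt : j == t = false by rewrite -it eq_sym (negbTE ij).
      have jr : r != j by apply: contraNneq B'ij => <-; rewrite it h'hr eqxx h'E hrt.
      by rewrite Or // jt !mulr0n !mulr0 addr0.
    rewrite !mulr0n !mulr0 add0r addr0.
    have [jt|jt] := eqVneq j t; last by rewrite mulr0n mulr0.
    have ir : i != r by apply: contraNneq B'ij => ->; rewrite jt h'hr eqxx h'E hrt.
    by rewrite Or' // mulr0.
- have Lr i : L i r = 0.
    by apply: LD; rewrite /= h'hr; have [->|] := eqVneq i t; rewrite ?h'E ?hrt.
  have Or j : r != j -> j != t -> Om r j = 0.
    by move=> rj jt; apply: OB => //=; rewrite h'hr (negbTE jt) andbF.
  have Osym i j : Om i j = Om j i by case: Opos => E _; rewrite -[in LHS]E mxE.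
  have Or0 : Om r r != 0.
    have [_ /(_ (delta_mx r 0))] := Opos.
    rewrite trmx_delta -rowE -colE !mxE => Opp; apply/lt0r_neq0/Opp.
    by apply/eqP => /matrixP/(_ r 0); rewrite !mxE !eqxx => /eqP; rewrite oner_eq0.
  have cE : (- (Om r t / Om r r)) * Om r r = - Om r t by rewrite mulNr divfK.
  (* [Om r t / Om r r] is the regression coefficient of the noise at [t] on that at [r]. Subtracting
     the fitted part decorrelates the two, and the quotient becomes the coefficient of [r -> t]. *)
  apply: (model_recombine (P := 1%:M + (- (Om r t / Om r r)) *: delta_mx r t)) => //=.
  + exact: add_transvection_unit.
  + move=> i j Dij; rewrite transvectionE !mxE Lr subr0.
    have [jr|jr] := eqVneq j r.
      by rewrite jr (negbTE rt) mulr0n mulr0 addr0 Lr subr0.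
    have Lij : L i j = 0.
      apply: LD; apply: contra Dij => /=; rewrite (h'r _ j) // => /andP[-> /=].
      by apply: contra => hji; rewrite h'E hji.
    have [jt|jt] := eqVneq j t; last by rewrite Lij subr0 mulr0n mulr0 addr0.
    have [ir|ir] := eqVneq i r.
      by move: Dij; rewrite ir jt hrt hr.
    by rewrite Lij subr0 mulr0n mul0rn mulr0 addr0.
  + move=> i j ij Bij; rewrite transvection_congrE.
    have [it|it] := eqVneq i t.
      have jt : j == t = false by rewrite -it eq_sym (negbTE ij).
      rewrite jt mulr0n mulr0 addr0 mulr1n.
      have [jr|jr] := eqVneq j r; first by rewrite jr cE it (Osym t) subrr.
      rewrite (Or j) ?jt // 1?eq_sym //.
      rewrite mulr0 addr0; apply: OB => //=; apply: contra Bij.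
      by rewrite it !h'E (negbTE jr) jt !andbF !orbF.
    rewrite !mulr0n !mulr0 !addr0.
    have [jt|jt] := eqVneq j t.
      rewrite mulr1n.
      have [ir|ir] := eqVneq i r; first by rewrite ir cE jt subrr.
      rewrite (Osym i r) (Or i) // 1?eq_sym //.
      rewrite mulr0 addr0; apply: OB => //=; apply: contra Bij.
      by rewrite jt !h'E (negbTE ir) (negbTE it) !andbF !orbF.
    rewrite mulr0n mulr0 addr0; apply: OB => //=; apply: contra Bij.
    by rewrite !h'E (negbTE it) (negbTE jt) !orbF.
Qed.

(** * Monomial column operations *)

Lemma monomial_unit (R : realType) n (q : 'I_n -> 'I_n) (s : 'I_n -> R) :
  injective q -> (forall i, s i != 0) ->
  \matrix_(k, i) (s i *+ (k == q i)) \in unitmx.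
Proof.
move=> qinj s0.
have -> : \matrix_(k, i) (s i *+ (k == q i)) =
    (perm_mx (perm qinj))^T *m diag_mx (\row_i s i).
  apply/matrixP => k i; rewrite mul_mx_diag !mxE permE eq_sym.
  by rewrite mulr_natl.
rewrite unitmx_mul unitmx_tr unitmx_perm unitmxE det_diag unitfE /=.
by apply/prodf_neq0 => i _; rewrite mxE.
Qed.

Lemma mulmx_monomialE (R : realType) n (q : 'I_n -> 'I_n) (s : 'I_n -> R)
    (A : 'M[R]_n) i j :
  (A *m \matrix_(k, i) (s i *+ (k == q i))) i j = s j * A i (q j).
Proof.
rewrite mxE (bigD1 (q j)) //= big1 ?addr0 => [|k /negbTE kq].
  by rewrite mxE eqxx mulrC.
by rewrite mxE kq mulr0.
Qed.

Lemma monomial_congrE (R : realType) n (q : 'I_n -> 'I_n) (s : 'I_n -> R)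
    (A : 'M[R]_n) (P := \matrix_(k, i) (s i *+ (k == q i))) i j :
  (P^T *m A *m P) i j = s j * (s i * A (q i) (q j)).
Proof.
rewrite mulmx_monomialE -[P^T *m A]trmxK trmx_mul trmxK mxE.
by rewrite mulmx_monomialE mxE.
Qed.

(** * Structure of the discrepancies once no move is left *)

Definition heads_equivalent n (h1 h2 : rel 'I_n) : Prop :=
  [/\ irreflexive h1, irreflexive h2,
      forall i j, h1 i j || h1 j i = h2 i j || h2 j i &
      forall i j k, i != k -> h1 i j && h1 k j = h2 i j && h2 k j].

Lemma heads_equivalent_sym n (h1 h2 : rel 'I_n) :
  heads_equivalent h1 h2 -> heads_equivalent h2 h1.
Proof. by case=> ? ? skel coll; split=> // *; rewrite (skel, coll). Qed.

(** A second head at [j] would complete a collider of [h1] that [h2] lacks. *)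
Lemma discrepant_head_unique n (h1 h2 : rel 'I_n) (i j k : 'I_n) :
  heads_equivalent h1 h2 -> h1 i j -> h2 i j = false -> h1 k j -> k = i.
Proof.
case=> _ _ _ coll h1ij h2ij h1kj; apply/eqP; rewrite eq_sym; apply/negPn/negP.
by move=> /(coll i j k); rewrite h1ij h1kj h2ij.
Qed.

(* No discrepancy between [h1] and [h2] can be repaired by adding or removing
   in [h1] a single head at an otherwise headless vertex. *)
Definition move_exhausted n (h1 h2 : rel 'I_n) : Prop :=
  (forall r t, h1 r t -> h1 t r -> h2 t r) /\
  (forall r t, h1 r t -> h1 t r = false -> h2 t r -> exists k, h1 k r).

Definition reversed_at n (h1 h2 : rel 'I_n) (i p : 'I_n) : Prop :=
  [/\ h1 p i, h2 p i = false, h2 i p & h1 i p = false].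

(** Were the edge bidirected in [h1], the first clause of exhaustion would put its head at [i] into
    [h2]. So it is [p -> i] in [h1], and the skeleton leaves only [i -> p] for [h2]. *)
Lemma exhausted_reversed n (h1 h2 : rel 'I_n) (i p : 'I_n) :
  heads_equivalent h1 h2 -> move_exhausted h1 h2 ->
  h1 p i -> h2 p i = false -> reversed_at h1 h2 i p.
Proof.
move=> [_ _ skel _] [ex1 _] h1pi h2pi.
have h1ip : h1 i p = false.
  by apply/negP => h1ip; rewrite (ex1 _ _ h1ip h1pi) in h2pi.
by split=> //; have := skel i p; rewrite h1pi h2pi orbT orbF => <-.
Qed.

(** Exhaustion of [h2] gives [i] a head in [h2] from some [q]. In [h1] the only head at [i] comes
    from [p], so this edge is reversed as well and the path [p -> i] of [h1] continues to [q]. *)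
Lemma exhausted_out n (h1 h2 : rel 'I_n) (i p : 'I_n) :
  heads_equivalent h1 h2 -> move_exhausted h1 h2 -> move_exhausted h2 h1 ->
  h1 p i -> h2 p i = false -> exists q, reversed_at h2 h1 i q.
Proof.
move=> E ex1 ex2 h1pi h2pi.
have [_ _ h2ip _] := exhausted_reversed E ex1 h1pi h2pi.
have [q h2qi] := ex2.2 _ _ h2ip h2pi h1pi.
exists q; apply: exhausted_reversed (h2qi) _ => //.
  exact: heads_equivalent_sym.
apply/negP => h1qi; have qp := discrepant_head_unique E h1pi h2pi h1qi.
by rewrite -qp h2qi in h2pi.
Qed.

(** [q] follows the reversed edge of [h1] leaving [i], and fixes [i] where the heads agree. By
    [exhausted_out], any disagreement at [i] yields such an edge. *)
Lemma exhausted_next n (h1 h2 : rel 'I_n) :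
  heads_equivalent h1 h2 -> move_exhausted h1 h2 -> move_exhausted h2 h1 ->
  exists q : 'I_n -> 'I_n, forall i,
    (q i = i /\ forall k, h1 k i = h2 k i) \/ (q i != i /\ reversed_at h2 h1 i (q i)).
Proof.
move=> E ex1 ex2.
have /choice[q qP] : forall i, exists j,
    (j = i /\ forall k, h1 k i = h2 k i) \/ (j != i /\ reversed_at h2 h1 i j).
  move=> i; have [/existsP[q /andP[h2qi /negbTE h1qi]]|] :=
      boolP [exists q, h2 q i && ~~ h1 q i].
    exists q; right; split; last first.
      by apply: exhausted_reversed => //; exact: heads_equivalent_sym.
    by apply: contraFneq h1qi => qi; case: E => _ /(_ i); rewrite -{1}qi h2qi.
  rewrite negb_exists => /forallP noq; exists i; left; split=> // k.
  apply/idP/idP => [h1ki|h2ki]; last by have := noq k; rewrite h2ki negbK.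
  apply/negPn/negP => /negbTE h2ki.
  have [q [h2qi h1qi _ _]] := exhausted_out E ex1 ex2 h1ki h2ki.
  by have := noq q; rewrite h2qi h1qi.
by exists q.
Qed.

(* With [q i] the vertex following [i] on its cycle, the equation
   [X_(q i) = l X_i + e_(q i)] is solved for [X_i]; in terms of [I - L], column
   [q i] divided by [- l] becomes column [i]. *)
Lemma generic_model_exhausted (R : realType) n (h1 h2 : rel 'I_n) :
  heads_equivalent h1 h2 -> move_exhausted h1 h2 -> move_exhausted h2 h1 ->
  @generic_model R n (graph_of_heads h1) `<=` model R (graph_of_heads h2).
Proof.
move=> E ex1 ex2 _ [L [Om [[LD Lunit] Lgen [Opos OB] ->]]].
have [q qP] := exhausted_next E ex1 ex2.
have [h1irr h2irr skel _] := E.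
have h1q i : q i != i -> forall k, h1 k (q i) = (k == i).
  case: (qP i) => [[-> _]|[_ [_ _ h1iq h2iq]] _ k]; first by rewrite eqxx.
  apply/idP/eqP => [|-> //]; exact: discrepant_head_unique h1iq h2iq.
(* Moved vertices with a common image coincide, since that image has one head in [h1]. A fixed
   vertex is not the image of a moved one, because its heads agree in both graphs. *)
have qinj : injective q.
  move=> i j qij; case: (qP i) => [[qi hi]|[qi _]]; last first.
    case: (qP j) => [[qj hj]|[qj _]].
      have := qP i => -[[qii]|[_ [_ _]]]; first by rewrite qii eqxx in qi.
      by rewrite qij qj hj => ->.
    by apply/eqP; rewrite -(h1q j qj) -qij h1q.
  case: (qP j) => [[<- _]|[_ [_ _]]]; first by rewrite -qij qi.
  by rewrite -qij qi hi => ->.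
pose s i := if q i == i then 1 else - (L i (q i))^-1.
have Lq i : q i != i -> L i (q i) != 0.
  move=> qi; apply: Lgen => /=; rewrite h1q // eqxx.
  by case: (qP i) => [[/eqP]|[_ [_ -> _ _]]]; rewrite ?(negbTE qi).
have Lii i : L i i = 0 by apply: LD; rewrite /= h1irr.
apply: (model_recombine (P := \matrix_(k, i) (s i *+ (k == q i)))) => //.
- apply: monomial_unit => // i; rewrite /s; case: ifPn => [_|qi].
    exact: oner_neq0.
  by rewrite oppr_eq0 invr_eq0 Lq.
- move=> k i /= D2ki; rewrite mulmx_monomialE !mxE /s.
  case: (qP i) => [[qi hi]|[qi [h2qi h1qi h1iq h2iq]]].
    rewrite qi eqxx mul1r LD ?subr0 //=; apply: contra D2ki.
    rewrite hi => /andP[h2ki /negbTE h1ik]; rewrite h2ki /=.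
    by apply/negP => h2ik; have := ex2.1 _ _ h2ki h2ik; rewrite h1ik.
  (* Column [q i] of [1%:M - L] lives in rows [i] and [q i]. After scaling, the first entry is the
     diagonal 1 and the second belongs to the reversed edge [q i -> i]. *)
  rewrite (negbTE qi); have [ki|ki] := eqVneq k i.
    by rewrite ki eq_sym (negbTE qi) sub0r mulrNN mulVf // Lq.
  have kq : k != q i by apply: contraNneq D2ki => ->; rewrite h2qi h2iq.
  rewrite (negbTE kq) (LD k) ?subr0 ?mulr0 //=.
  by rewrite h1q // (negbTE ki).
- move=> i j ij /= B2ij; rewrite monomial_congrE OB ?mulr0 //.
    by rewrite (inj_eq qinj).
  (* No bidirected edge of [h1] meets a cycle: the only head at a moved [q i] is that of the
     directed edge [i -> q i]. *)
  apply: contra B2ij => /= /andP[].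
  case: (qP i) => [[qi hi]|[qi [h2qi h1qi h1iq h2iq]]]; last first.
    by move=> hij; rewrite (h1q i qi) => /eqP qj; rewrite qj h1qi in hij.
  case: (qP j) => [[qj hj]|[qj [h2qj h1qj h1jq h2jq]]]; last first.
    by rewrite (h1q j qj) => /eqP ->; rewrite h1qj.
  by rewrite qi qj hi hj => -> ->.
Qed.

(** * Induction on the number of discrepancies *)

Definition discrepancy n (h1 h2 : rel 'I_n) : nat :=
  #|[pred e : 'I_n * 'I_n | h1 e.1 e.2 != h2 e.1 e.2]|.

Lemma discrepancyC n (h1 h2 : rel 'I_n) : discrepancy h1 h2 = discrepancy h2 h1.
Proof. by apply: eq_card => e; rewrite !inE eq_sym. Qed.

Lemma discrepancy_repair n (h1 h1' h2 : rel 'I_n) (r t : 'I_n) :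
  (forall i j, (i, j) != (t, r) -> h1' i j = h1 i j) ->
  h1' t r = h2 t r -> h1 t r != h2 t r ->
  (discrepancy h1' h2 < discrepancy h1 h2)%N.
Proof.
move=> h1'E h1'tr h1tr; apply: proper_card; apply/properP; split.
  apply/fintype.subsetP => -[i j]; rewrite !inE /=; have [[-> ->]|ne] := eqVneq (i, j) (t, r).
    by rewrite h1'tr eqxx.
  by rewrite h1'E.
by exists (t, r); rewrite !inE /= ?h1'tr ?eqxx.
Qed.

(** Before and after the change, a head at [r] can only come from [t], so [r] is the middle of no
    collider. The head at [t] keeps the two vertices adjacent. *)
Lemma heads_equivalent_headless n (h h' h2 : rel 'I_n) (r t : 'I_n) :
  h r t -> (forall k, k != t -> h k r = false) -> r != t ->
  (forall i j, (i, j) != (t, r) -> h' i j = h i j) ->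
  heads_equivalent h h2 -> heads_equivalent h' h2.
Proof.
move=> hrt hr rt h'E [hirr h2irr skel coll].
have h'rt : h' r t by rewrite h'E // xpair_eqE (negbTE rt).
have h'r k : k != t -> h' k r = false.
  by move=> kt; rewrite h'E ?hr // xpair_eqE (negbTE kt).
split=> //.
- move=> i; rewrite h'E ?hirr //; apply: contraNneq rt => -[<- ->]//.
- move=> i j; rewrite -skel.
  have [[-> ->]|ne1] := eqVneq (i, j) (t, r); first by rewrite h'rt hrt !orbT.
  have [[-> ->]|ne2] := eqVneq (j, i) (t, r); first by rewrite h'rt hrt.
  by rewrite !h'E.
- move=> i j k ik; rewrite -coll //.
  have [->|jr] := eqVneq j r; last by rewrite !h'E // xpair_eqE (negbTE jr) andbF.
  have [it|it] := eqVneq i t; last by rewrite h'r // hr.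
  have kt : k != t by rewrite -it eq_sym.
  by rewrite (h'r k) // (hr k) // !andbF.
Qed.

Lemma repair_head (R : realType) n (h1 h2 : rel 'I_n) :
  heads_equivalent h1 h2 -> ~ move_exhausted h1 h2 ->
  exists h1', [/\ heads_equivalent h1' h2,
    model R (graph_of_heads h1') = model R (graph_of_heads h1) &
    (discrepancy h1' h2 < discrepancy h1 h2)%N].
Proof.
move=> E nex; have [h1irr h2irr skel coll] := E.
suff : exists r t, [/\ h1 r t, forall k, k != t -> h1 k r = false &
                       h1 t r != h2 t r].
  move=> [r [t [h1rt h1r h1tr]]].
  have rt : r != t by apply: contraTneq h1rt => ->; rewrite h1irr.
  (* [h b] sets the head at [r] on the edge to [t] to [b]. Both values give the same model, so the
     value in [h2] may be chosen. *)
  pose h b : rel 'I_n := fun i j => if (i, j) == (t, r) then b else h1 i j.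
  have hE b i j : (i, j) != (t, r) -> h b i j = h1 i j by rewrite /h => /negbTE ->.
  have htr b : h b t r = b by rewrite /h eqxx.
  have hb : h (h1 t r) = h1.
    apply/funext => i; apply/funext => j; rewrite /h.
    by case: eqP => [[-> ->]|].
  have modelh : model R (graph_of_heads (h false)) = model R (graph_of_heads (h true)).
    apply: (@model_add_head _ _ _ _ r t).
    - move=> i; rewrite /h xpair_eqE; case: ifP => // _; exact: h1irr.
    - by rewrite hE // xpair_eqE (negbTE rt).
    - move=> k; have [->|kt] := eqVneq k t; first exact: htr.
      by rewrite hE ?h1r // xpair_eqE (negbTE kt).
    - by move=> i j; rewrite /h xpair_eqE; case: ifP; rewrite ?orbT ?orbF.
  exists (h (h2 t r)); split.
  - exact: (heads_equivalent_headless h1rt h1r rt (hE _)).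
  - by rewrite -[in RHS]hb; move: h1tr modelh; case: (h1 t r); case: (h2 t r).
  - by apply: discrepancy_repair h1tr => //; exact: hE.
move: nex => /not_andP[/existsNP[r /existsNP[t]]|/existsNP[r /existsNP[t]]].
  move=> /not_implyP[h1rt /not_implyP[h1tr /negP/negbTE h2tr]].
  exists r, t; split=> //; last by rewrite h1tr h2tr.
  move=> k kt; apply/negbTE; apply: contraNN kt => h1kr.
  by apply/eqP; exact: discrepant_head_unique h1tr h2tr h1kr.
move=> /not_implyP[h1rt /not_implyP[h1tr /not_implyP[h2tr /forallNP noh]]].
exists r, t; split=> //; last by rewrite h1tr h2tr.
by move=> k _; apply/negbTE/negP.
Qed.

(** A repair in either graph keeps its model and lowers the discrepancy. If none is left, cycle
    reversal puts the generic covariance matrices of each graph in the model of the other, and these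
    are dense. *)
Lemma closure_model_heads (R : realType) n (h1 h2 : rel 'I_n) :
  heads_equivalent h1 h2 ->
  closure (model R (graph_of_heads h1)) = closure (model R (graph_of_heads h2)).
Proof.
have [m] := ubnP (discrepancy h1 h2); elim: m h1 h2 => // m IHm h1 h2 hm E.
have E' := heads_equivalent_sym E.
have [ex1|/(repair_head R E)[h1' [E1 <- lt1]]] := pselect (move_exhausted h1 h2);
  last by apply: IHm E1; exact: leq_trans lt1 _.
have [ex2|/(repair_head R E')[h2' [E2 <- lt2]]] := pselect (move_exhausted h2 h1);
  last first.
  apply/esym/IHm => //; rewrite discrepancyC in hm; exact: leq_trans lt2 _.
have sub g1 g2 : heads_equivalent g1 g2 -> move_exhausted g1 g2 ->
    move_exhausted g2 g1 ->
    closure (model R (graph_of_heads g1)) `<=` closure (model R (graph_of_heads g2)).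
  move=> Eg exg1 exg2; apply: subset_trans; last exact: closed_closure.
  apply: closureS; apply: subset_trans; first exact: model_sub_closure_generic.
  exact/closureS/generic_model_exhausted.
by apply/seteqP; split; apply: sub.
Qed.

Theorem theorem2 (R : realType) (n : nat) (G1 G2 : mixed_graph n) :
  simple_mixed_graph G1 -> simple_mixed_graph G2 ->
  same_skeleton G1 G2 -> same_colliders G1 G2 ->
  closure (model R G1) = closure (model R G2).
Proof.
move=> S1 S2 skel coll; rewrite -(head_atK S1) -(head_atK S2).
have head_irr G : simple_mixed_graph G -> irreflexive (@head_at n G).
  by move=> [[Dirr [Birr _]] _] i; rewrite /head_at (negbTE (Dirr i)) (negbTE (Birr i)).
have adjE G i j : simple_mixed_graph G ->
    head_at G i j || head_at G j i = Defs.adjacent G i j.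
  move=> [[_ [_ Bsym]] _]; rewrite /head_at /Defs.adjacent (Bsym j i).
  by case: (mg_D G i j); case: (mg_D G j i); case: (mg_B G i j).
apply: closure_model_heads; split; try exact: head_irr.
- by move=> i j; rewrite !adjE.
- by move=> i j k ik; have := coll i j k; rewrite /collider ik.
Qed.
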